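(* Let $g\ge 2$. There exists a unique fixed point for the $\mathfrak{S}_{2g+2}$ action on the set $\mathcal{C}$ of spin structures of $\Sigma_g$ (i.e. a unique $c\in\mathcal{C}$ with $c\circ\sigma=c$ for all $\sigma\in\mathfrak{S}_{2g+2}$) if and only if $g$ is odd (hence $g\ge 3$). In that case the corresponding matrix of the fixed point is the $2\times g$ matrix $$\begin{pmatrix}1&1&1&1&\cdots&1&1&1\\ 1&0&1&0&\cdots&1&0&1\end{pmatrix},$$ whose odd-numbered columns are $\begin{pmatrix}1\\1\end{pmatrix}$ and whose even-numbered columns are $\begin{pmatrix}1\\0\end{pmatrix}$.
   Context: $\Sigma_g$ is a compact connected oriented surface of genus $g$, and $\alpha_1,\dots,\alpha_g,\beta_1,\dots,\beta_g$ is a symplectic basis of $H_1(\Sigma_g,\mathbb{Z}/2)$, i.e. $\alpha_i\cdot\beta_j=\delta_{ij}$, $\alpha_i\cdot\alpha_j=\beta_i\cdot\beta_j=0$ for the mod 2 intersection number. A spin structure is a map $c:H_1(\Sigma_g,\mathbb{Z}/2)\to\mathbb{Z}/2$ with $c(x+y)=c(x)+c(y)+x\cdot y$ for all $x,y$; $\mathcal{C}$ is the set of spin structures. The corresponding matrix of $c$ is the $2\times g$ matrix $M$ over $\mathbb{Z}/2$ whose $i$-th column is $\begin{pmatrix}c(\alpha_i)\\c(\beta_i)\end{pmatrix}$; it determines $c$, and every $2\times g$ matrix over $\mathbb{Z}/2$ arises. For $\gamma\in H_1(\Sigma_g,\mathbb{Z}/2)$ let $T_\gamma(x)=x+(x\cdot\gamma)\gamma$,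 an element of the group $Sp_{2g}(\mathbb{Z}/2)$ of automorphisms preserving the intersection number. Let $\sigma_i=(i,i+1)\in\mathfrak{S}_{2g+2}$, $1\le i\le 2g+1$, where $\mathfrak{S}_n$ is the symmetric group. The group $\mathfrak{S}_{2g+2}$ acts through the homomorphism $\iota:\mathfrak{S}_{2g+2}\to Sp_{2g}(\mathbb{Z}/2)$ determined by $\iota(\sigma_1)=T_{\beta_1}$, $\iota(\sigma_{2g+1})=T_{\beta_g}$, $\iota(\sigma_{2i})=T_{\alpha_i}$ ($1\le i\le g$), $\iota(\sigma_{2j+1})=T_{\beta_j+\beta_{j+1}}$ ($1\le j\le g-1$). It acts on $\mathcal{C}$ from the right by $c\circ\sigma:=c\circ\iota(\sigma)$. *)

(* Defs.v *)
From HB Require Import structures.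
From mathcomp Require Import all_boot all_order all_fingroup all_algebra.

Set Implicit Arguments.
Unset Strict Implicit.
Unset Printing Implicit Defensive.

Import GRing.Theory.
Local Open Scope ring_scope.

(* The surface of genus g enters only through its first homology: the pair
   (H_1(Sigma_g, Z/2), mod 2 intersection number) is modelled by an 'F_2-vector
   space V with an alternating bilinear form [dot] and a symplectic basis
   (alpha_i, beta_i), i < g.  Every such (V, dot) is isometric to the homology
   of Sigma_g, and over 'F_2 alternating implies symmetric. *)
Section Spin.
Variables (g : nat) (V : vectType 'F_2) (dot : {biscalar V}).
Variables (alpha beta : 'I_g -> V).

Definition alternating := forall x, dot x x = 0.

Definition symplectic_basis :=
  [/\ basis_of {:V} (codom alpha ++ codom beta),
      forall i j, dot (alpha i) (beta j) = (i == j)%:R,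
      forall i j, dot (alpha i) (alpha j) = 0
    & forall i j, dot (beta i) (beta j) = 0].

(* Membership in Sp(V): an automorphism preserving the form. *)
Definition symplectic (f : 'End(V)) :=
  lker f = 0%VS /\ forall x y, dot (f x) (f y) = dot x y.

Definition transvection (c x : V) : V := x + dot x c *: c.

(* sigma i = (i, i+1) for 1 <= i <= 2g+1; the points 1, ..., 2g+2 are the
   elements 0, ..., 2g+1 of 'I_(2g+2). *)
Definition sigma (i : nat) : 'S_(2 * g).+2 := tperm (inord i.-1) (inord i).

(* iota is a homomorphism S_(2g+2) -> Sp(V) with the prescribed values on the
   generators sigma i (which determine it).  In MathComp s * t applies s first,
   so it is the composite "t o s".  The vectors alpha i, beta i are numbered
   from 0: alpha i is alpha_(i+1), so it goes with sigma (2 (i+1)). *)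
Definition is_iota (iota : 'S_(2 * g).+2 -> 'End(V)) :=
  [/\ forall s, symplectic (iota s),
      forall s t, iota (s * t)%g = (iota t \o iota s)%VF
    & [/\ forall i : 'I_g, i = 0%N :> nat ->
            iota (sigma 1) =1 transvection (beta i),
          forall i : 'I_g, i.+1 = g ->
            iota (sigma (2 * g).+1) =1 transvection (beta i),
          forall i : 'I_g,
            iota (sigma (2 * i.+1)) =1 transvection (alpha i)
        & forall i j : 'I_g, j = i.+1 :> nat ->
            iota (sigma (2 * i.+1).+1) =1 transvection (beta i + beta j)]].

Definition spin_structure (c : V -> 'F_2) :=
  forall x y, c (x + y) = c x + c y + dot x y.

Definition fixed_spin (iota : 'S_(2 * g).+2 -> 'End(V)) (c : V -> 'F_2) :=
  spin_structure c /\ forall s, c \o iota s = c.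

Definition spin_matrix (c : V -> 'F_2) : 'M['F_2]_(2, g) :=
  \matrix_(i, j) if i == 0 then c (alpha j) else c (beta j).

End Spin.

(* Columns are numbered from 0, so the odd-numbered columns of the usual
   numbering are those of even index j. *)
Definition fixed_matrix (g : nat) : 'M['F_2]_(2, g) :=
  \matrix_(i, j) if i == 0 then 1 else (~~ odd j)%:R.

(* Main.v *)
(** If [c] is a spin structure, then [c (T_v x) = c x + (x . v) (c v + 1)];
    as the form is nondegenerate, [c] is invariant under the transvection
    along [v <> 0] exactly when [c v = 1].  Since the [sigma_i] generate the
    symmetric group, [c] is fixed iff [c] is 1 on every [alpha_i], on
    [beta_1], on [beta_g] and on every [beta_j + beta_(j+1)].  The last
    condition says that [c] alternates along the [beta_j], so that
    [c beta_1 = 1] forces the given matrix, and [c beta_g = 1] then means that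
    [g] is odd. *)

Require Import Defs.
From mathcomp Require Import all_boot all_order all_fingroup all_algebra.
From mathcomp Require Import zify ring.
From Stdlib Require Import FunctionalExtensionality.

(** Every permutation is a product of transpositions, and each transposition is built from adjacent
    ones by induction on the gap: conjugating [(x, m)] by [(m, m+1)] gives [(x, m+1)]. It is needed
    because [iota] is prescribed only on adjacent transpositions. *)
Lemma perm_adjacent_ind (n : nat) (P : 'S_n.+1 -> Prop) :
  P 1%g -> (forall s t, P s -> P t -> P (s * t)%g) ->
  (forall i, i < n -> P (tperm (inord i) (inord i.+1))) ->
  forall s, P s.
Proof.
move=> P1 PM Padj.
have Plt (x k : nat) : x + k < n -> P (tperm (inord x) (inord (x + k).+1)).
  elim: k => [|k IHk] xkn; first by rewrite addn0 in xkn *; apply: Padj.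
  have inordE i : i <= n -> (inord i : 'I_n.+1) = i :> nat by move=> ?; rewrite inordK.
  rewrite addnS -(_ : (tperm (inord x) (inord (x + k).+1) ^
                       tperm (inord (x + k).+1) (inord (x + k).+2))%g
                      = tperm (inord x) (inord (x + k).+2)).
    have Ptp : P (tperm (inord (x + k).+1) (inord (x + k).+2)) by apply: Padj; lia.
    by rewrite conjgE tpermV; apply: (PM) => //; apply: PM => //; apply: IHk; lia.
  rewrite tpermJ tpermL tpermD //; apply/eqP => /(congr1 val) /=;
    by rewrite !inordE; lia.
have Pltn (x y : 'I_n.+1) : x < y -> P (tperm x y).
  move=> ltxy; rewrite -[x]inord_val -[y]inord_val.
  have -> : nat_of_ord y = (x + (y - x.+1)).+1 by lia.
  by apply: Plt; have := ltn_ord y; lia.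
move=> s; have [ts -> _] := prod_tpermP s.
apply: big_ind => // -[x y] _ /=.
by case: (ltngtP x y) => [/Pltn//|/Pltn|/val_inj ->]; rewrite ?tperm1 // tpermC.
Qed.

Section F2.

Local Open Scope ring_scope.

Lemma F2_cases (a : 'F_2) : a = 0 \/ a = 1.
Proof. by case: a => [[|[|//]]] ?; [left|right]; apply: val_inj. Qed.

Lemma F2_addrr (a : 'F_2) : a + a = 0.
Proof. exact: (GRing.addrr_pchar2 (pchar_Fp (isT : prime 2))). Qed.

Lemma F2_add_eq1 (a b : 'F_2) : a + b = 1 <-> b = a + 1.
Proof.
by split=> [<-|->]; rewrite GRing.addrA F2_addrr GRing.add0r.
Qed.

End F2.

Section SpinTheory.

Local Open Scope ring_scope.
Import GRing.Theory.

Context {g : nat} {V : vectType 'F_2} {dot : {biscalar V}}.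
Context {alpha beta : 'I_g -> V}.
Hypothesis dot_alt : alternating dot.
Hypothesis basis : symplectic_basis dot alpha beta.

Lemma dotC x y : dot x y = dot y x.
Proof.
have := dot_alt (x + y).
rewrite linearDl !linearDr !dot_alt add0r addr0.
by case: (F2_cases (dot x y)) (F2_cases (dot y x)) => [] -> [] -> /eqP.
Qed.

Lemma dot_ab i j : dot (alpha i) (beta j) = (i == j)%:R.
Proof. by case: basis. Qed.

Lemma dot_ba i j : dot (beta i) (alpha j) = (i == j)%:R.
Proof. by rewrite dotC dot_ab eq_sym. Qed.

Lemma dot_aa i j : dot (alpha i) (alpha j) = 0.
Proof. by case: basis. Qed.

Lemma dot_bb i j : dot (beta i) (beta j) = 0.
Proof. by case: basis. Qed.

Lemma sum_delta (a : 'I_g -> 'F_2) j : \sum_i a i * (i == j)%:R = a j.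
Proof.
rewrite (bigD1 j) //= eqxx mulr1 big1 ?addr0 // => i /negPf ->.
by rewrite mulr0.
Qed.

(** Spanning provides some coefficients; pairing with [beta j] kills every term except that of
    [alpha j], and symmetrically, so each coefficient is a pairing with the dual basis vector. *)
Lemma symplectic_expansion x :
  x = \sum_i dot x (beta i) *: alpha i + \sum_i dot x (alpha i) *: beta i.
Proof.
have [a [b ->]] : exists a b : 'I_g -> 'F_2,
    x = \sum_i a i *: alpha i + \sum_i b i *: beta i.
  have span_codom (e : 'I_g -> V) v : v \in <<codom e>>%VS ->
      exists a : 'I_g -> 'F_2, v = \sum_i a i *: e i.
    rewrite span_def big_image /= => /memv_sumP[vs vs_e ->].
    have /fin_all_exists[a vsE] i : exists k, vs i = k *: e i.
      exact/vlineP/vs_e.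
    by exists a; apply: eq_bigr => i _; rewrite vsE.
  have := memvf x; case: basis => /span_basis <- _ _ _.
  rewrite span_cat => /memv_addP[u /span_codom[a ->] [v /span_codom[b ->] ->]].
  by exists a, b.
congr (_ + _); apply: eq_bigr => j _; congr (_ *: _);
  rewrite linearDl !linear_sumlz.
  rewrite [X in _ = _ + X]big1 ?addr0; last first.
    by move=> i _; rewrite linearZl_LR /= dot_bb mulr0.
  rewrite -[LHS]sum_delta; apply: eq_bigr => i _.
  by rewrite linearZl_LR /= dot_ab.
rewrite [X in _ = X + _]big1 ?add0r; last first.
  by move=> i _; rewrite linearZl_LR /= dot_aa mulr0.
rewrite -[LHS]sum_delta; apply: eq_bigr => i _.
by rewrite linearZl_LR /= dot_ba.
Qed.

(** Serves to recognise [dot] as the polarization of the explicit quadratic form in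
    [spin_matrix_surj]. *)
Lemma dot_expansion x y :
  dot x y = \sum_i (dot x (beta i) * dot y (alpha i)
                    + dot x (alpha i) * dot y (beta i)).
Proof.
rewrite {1}(symplectic_expansion x) linearDl !linear_sumlz big_split /=.
by congr (_ + _); apply: eq_bigr => i _; rewrite linearZl_LR /= (dotC y).
Qed.

Section SpinStructure.

Variable c : V -> 'F_2.
Hypothesis spin_c : spin_structure dot c.

Lemma spin0 : c 0 = 0.
Proof.
have := spin_c 0 0; rewrite addr0 dot_alt addr0 F2_addrr.
by [].
Qed.

(** A spin structure is a quadratic form, so the scalar comes out squared, and [a ^ 2 = a] in
    ['F_2]. *)
Lemma spin_scale a x : c (a *: x) = a * c x.
Proof.
by case: (F2_cases a) => ->; rewrite ?scale0r ?scale1r ?mul0r ?mul1r ?spin0.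
Qed.

Lemma spin_transvection v x :
  c (transvection dot v x) = c x + dot x v * (c v + 1).
Proof.
rewrite /transvection spin_c spin_scale linearZr_LR /= -addrA mulrDr mulr1.
by case: (F2_cases (dot x v)) => ->; rewrite ?mul0r ?mul1r.
Qed.

(** The vector [y] witnesses that [v] pairs nontrivially: evaluating the invariance at [y] leaves
    exactly [c v + 1 = 0]. *)
Lemma spin_transvection_invariant v y : dot y v = 1 ->
  (forall x, c (transvection dot v x) = c x) <-> c v = 1.
Proof.
move=> dyv; split=> [cT | cv1 x].
  move: (cT y); rewrite spin_transvection dyv mul1r => /eqP.
  rewrite -subr_eq0 addrAC subrr add0r.
  by case: (F2_cases (c v)) => ->.
by rewrite spin_transvection cv1 F2_addrr mulr0 addr0.
Qed.

End SpinStructure.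

(** Both maps have the same polarization [dot], so the set where they agree is closed under
    addition; it contains the basis. *)
Lemma spin_matrix_inj c c' : spin_structure dot c -> spin_structure dot c' ->
  spin_matrix alpha beta c = spin_matrix alpha beta c' -> c = c'.
Proof.
move=> spin_c spin_c' eqM.
have eq_a i : c (alpha i) = c' (alpha i).
  by have /matrixP/(_ 0 i) := eqM; rewrite !mxE.
have eq_b i : c (beta i) = c' (beta i).
  by have /matrixP/(_ 1 i) := eqM; rewrite !mxE.
apply: functional_extensionality => x.
have eq_add u v : c u = c' u -> c v = c' v -> c (u + v) = c' (u + v).
  by move=> eq_u eq_v; rewrite spin_c spin_c' eq_u eq_v.
have eq0 : c 0 = c' 0 by rewrite !spin0.
rewrite (symplectic_expansion x); apply: (eq_add);
  apply: (big_ind (fun v => c v = c' v)) => // i _.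
- by rewrite !spin_scale // eq_a.
- by rewrite !spin_scale // eq_b.
Qed.

Lemma spin_matrix_surj (M : 'M['F_2]_(2, g)) :
  exists2 c, spin_structure dot c & spin_matrix alpha beta c = M.
Proof.
(* In the coordinates [dot x (beta i)] along [alpha i] and [dot x (alpha i)] along [beta i], the
   products polarize to [dot], and the linear terms prescribe the values on the basis. *)
exists (fun x => \sum_i (dot x (beta i) * dot x (alpha i)
                 + dot x (beta i) * M 0 i + dot x (alpha i) * M 1 i)).
  move=> x y; rewrite dot_expansion -!big_split /=; apply: eq_bigr => i _.
  rewrite !linearDl; ring.
apply/matrixP => k j; rewrite mxE.
have [->|->] : k = 0 \/ k = 1.
  by case: k => [[|[|//]]] ?; [left|right]; apply: val_inj.
- rewrite /= -[RHS](sum_delta (M 0)); apply: eq_bigr => i _.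
  by rewrite dot_aa dot_ab mulr0 mul0r addr0 add0r mulrC eq_sym.
- rewrite /= -[RHS](sum_delta (M 1)); apply: eq_bigr => i _.
  by rewrite dot_bb dot_ba !mul0r !add0r mulrC eq_sym.
Qed.

(** Reduces invariance to one matrix equation and a parity condition, so that existence and
    uniqueness follow from the bijection between spin structures and matrices. *)
Lemma fixed_spin_iff (iota : 'S_(2 * g).+2 -> 'End(V)) c : (0 < g)%N ->
  is_iota dot alpha beta iota -> spin_structure dot c ->
  (forall s, c \o iota s = c) <->
  odd g /\ spin_matrix alpha beta c = fixed_matrix g.
Proof.
move=> g_gt0 [iota_sp iotaM [iota_first iota_last iota_even iota_odd]] spin_c.
have cE s v : iota s =1 transvection dot v ->
    (exists y, dot y v = 1) -> c \o iota s = c <-> c v = 1.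
  move=> sE [y dyv]; rewrite -(spin_transvection_invariant _ spin_c _ _ dyv); split.
    by move=> cs x; rewrite -sE -[RHS](congr1 (fun f => f x) cs).
  by move=> cT; apply: functional_extensionality => x /=; rewrite sE cT.
have nd_a i : exists y, dot y (alpha i) = 1.
  by exists (beta i); rewrite dot_ba eqxx.
have nd_b i : exists y, dot y (beta i) = 1.
  by exists (alpha i); rewrite dot_ab eqxx.
have nd_bb (i j : 'I_g) : j = i.+1 :> nat -> exists y, dot y (beta i + beta j) = 1.
  move=> ji; exists (alpha i); rewrite linearDr !dot_ab eqxx.
  by rewrite -val_eqE /= ji ltn_eqF ?ltnSn // addr0.
have c_bb i j : c (beta i + beta j) = c (beta i) + c (beta j).
  by rewrite spin_c dot_bb addr0.
split=> [c_fix | [odd_g cM]].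
  have c_a i : c (alpha i) = 1 by apply/(cE _ _ (iota_even i)).
  (* Induction along the chain: the first generator gives the initial value 1, and each
     [beta i + beta j] with [j = i.+1] flips the value. *)
  have c_b (i : 'I_g) : c (beta i) = (~~ odd i)%:R.
    case: i => i; elim: i => [|i IHi] lt_ig.
      by rewrite /=; apply/(cE _ _ (iota_first (Ordinal lt_ig) erefl)).
    have lt_ig' : (i < g)%N by lia.
    set j := Ordinal lt_ig; pose i' := Ordinal lt_ig'.
    have ji : j = i'.+1 :> nat by [].
    have := c_fix (sigma g (2 * i'.+1).+1).
    move/(cE _ _ (iota_odd _ _ ji) (nd_bb _ _ ji)); rewrite c_bb.
    by move/F2_add_eq1 => ->; rewrite IHi /=; case: (odd i); apply: val_inj.
  split; last first.
    by apply/matrixP => k j; rewrite !mxE; case: eqP; rewrite ?c_a ?c_b.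
  (* The last vector has index [g.-1], counting from 0; its value 1 makes [g.-1] even, hence [g]
     odd. *)
  have lt_g : (g.-1 < g)%N by lia.
  have last_g : (Ordinal lt_g).+1 = g by rewrite /= prednK.
  have /(cE _ _ (iota_last _ last_g) (nd_b _)) := c_fix (sigma g (2 * g).+1).
  by rewrite c_b /= -[odd g]negbK -oddS -{2}(prednK g_gt0) /= negbK; case: odd.
have c_a i : c (alpha i) = 1 by have /matrixP/(_ 0 i) := cM; rewrite !mxE.
have c_b (i : 'I_g) : c (beta i) = (~~ odd i)%:R.
  by have /matrixP/(_ 1 i) := cM; rewrite !mxE.
apply: perm_adjacent_ind => [|s t cs ct|i].
(* Multiplicativity makes [iota 1] idempotent; being injective, it is the identity. *)
- apply: functional_extensionality => x /=; congr c.
  have [/eqP ker0 _] := iota_sp 1%g; move/lker0P: ker0; apply.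
  by rewrite -comp_lfunE -iotaM mulg1.
- apply: functional_extensionality => x; rewrite iotaM /= comp_lfunE.
  by rewrite -[LHS]/((c \o iota t) (iota s x)) ct -[LHS]/((c \o iota s) x) cs.
rewrite ltnS -[tperm _ _]/(sigma g i.+1) => le_i.
(* The generator is [sigma g i.+1], so an odd [i] gives a transvection along some [alpha], and an
   even [i] strictly between 0 and [2 * g] one along a sum of two consecutive [beta], whose indices
   have opposite parities. *)
have [i0 | i_gt0] := posnP i.
  by rewrite i0; apply/(cE _ _ (iota_first (Ordinal g_gt0) erefl)); rewrite ?c_b.
have [i_odd | i_even] := boolP (odd i).
  have lt_k : (i./2 < g)%N by lia.
  have -> : i.+1 = (2 * (Ordinal lt_k).+1)%N by rewrite /=; lia.
  by apply/(cE _ _ (iota_even _)).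
have [i_last | i_nlast] := eqVneq i (2 * g)%N.
  have lt_g : (g.-1 < g)%N by lia.
  have last_g : (Ordinal lt_g).+1 = g by rewrite /= prednK.
  rewrite i_last; apply/(cE _ _ (iota_last _ last_g)) => //.
  by rewrite c_b /= -oddS prednK // odd_g.
have lt_k : (i./2.-1 < g)%N by lia.
have lt_k1 : (i./2 < g)%N by lia.
have kk1 : Ordinal lt_k1 = (Ordinal lt_k).+1 :> nat by rewrite /=; lia.
have -> : i.+1 = (2 * (Ordinal lt_k).+1).+1 by rewrite /=; lia.
apply/(cE _ _ (iota_odd _ _ kk1) (nd_bb _ _ kk1)).
by rewrite c_bb !c_b kk1 /=; case: (odd _); apply: val_inj.
Qed.

End SpinTheory.

Theorem theorem3p3 (g : nat) (V : vectType 'F_2) (dot : {biscalar V}%R)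
    (alpha beta : 'I_g -> V) (iota : 'S_(2 * g).+2 -> 'End(V)) :
  2 <= g ->
  alternating dot ->
  symplectic_basis dot alpha beta ->
  is_iota dot alpha beta iota ->
  ((exists! c : V -> 'F_2, fixed_spin dot iota c) <-> odd g) /\
  (odd g ->
     3 <= g /\
     forall c : V -> 'F_2, fixed_spin dot iota c ->
       spin_matrix alpha beta c = fixed_matrix g).
Proof.
move=> g_ge2 alt basis iotaP; have g_gt0 : 0 < g by lia.
have fixedE c (spin_c : spin_structure dot c) :=
  fixed_spin_iff alt basis iota c g_gt0 iotaP spin_c.
split; first split.
- by case=> c [[spin_c /fixedE[]]].
- move=> odd_g.
  (* The fixed point is the spin structure with the prescribed matrix; any other fixed point has the
     same matrix. *)
  have [c spin_c cM] := spin_matrix_surj alt basis (fixed_matrix g).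
  exists c; split; first by split=> //; apply/fixedE.
  move=> c' [spin_c' /fixedE[//|_ c'M]].
  by apply: (spin_matrix_inj alt basis) => //; rewrite cM.
- move=> odd_g; split; first by lia.
  by move=> c [spin_c /fixedE[]].
Qed.
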